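(* Let $n\geq 2$ and let $K_n$ be the complete graph on $n$ vertices. Then $\chi_i^{c}(K_n)=2n-2$ if $n$ is even, and $\chi_i^{c}(K_n)=2n$ if $n$ is odd.
   Context: An incidence of a graph $G$ is a pair $(v,e)$ where $v$ is a vertex and $e$ an edge incident with $v$. For a vertex $w$, let $I(w)$ be the set of all incidences $(u,e)$ such that $e$ is incident with $w$. Two incidences conflict if both lie in $I(w)$ for some vertex $w$. A conflict-free incidence $k$-coloring assigns colors from a $k$-element set to the incidences so that conflicting incidences get distinct colors; $\chi^{c}_i(G)$ is the least such $k$. *)

(* Defs.v *)
From mathcomp Require Import all_boot.

Set Implicit Arguments.
Unset Strict Implicit.
Unset Printing Implicit Defensive.

Record sgraph := SGraph {
  vertex :> finType;
  adj : rel vertex;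
  adj_sym : symmetric adj;
  adj_irr : irreflexive adj }.

Section Incidence.
Variable G : sgraph.

Definition edges : {set {set G}} :=
  [set e | [exists x, exists y, adj x y && (e == [set x; y])]].

Definition is_incidence (p : G * {set G}) : bool :=
  (p.2 \in edges) && (p.1 \in p.2).

Definition incidence := {p : G * {set G} | is_incidence p}.

(* I(w) constrains only the edge of an incidence: the end of that edge which
   the incidence selects need not be w. *)
Definition incidences_at (w : G) : {set incidence} :=
  [set i : incidence | w \in (val i).2].

Definition conflict (i j : incidence) : bool :=
  [exists w, (i \in incidences_at w) && (j \in incidences_at w)].

(* Every incidence conflicts with itself under [conflict], so the coloring
   condition is imposed on pairs of different incidences. *)
Definition conflict_free_coloring (k : nat) (c : {ffun incidence -> 'I_k}) :
    bool :=
  [forall i, forall j, (i != j) && conflict i j ==> (c i != c j)].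

Definition conflict_free_colorable (k : nat) : bool :=
  [exists c : {ffun incidence -> 'I_k}, conflict_free_coloring c].

Lemma conflict_free_colorable_card : exists k, conflict_free_colorable k.
Proof.
exists #|{: incidence}|; apply/existsP; exists [ffun i => enum_rank i].
apply/forallP => i; apply/forallP => j; apply/implyP => /andP[neq_ij _].
by rewrite !ffunE (inj_eq enum_rank_inj).
Qed.

Definition cf_incidence_chromatic_number : nat :=
  ex_minn conflict_free_colorable_card.

End Incidence.

Section Complete.
Variable n : nat.

Definition complete_adj : rel 'I_n := fun x y => x != y.

Lemma complete_adj_sym : symmetric complete_adj.
Proof. by move=> x y; rewrite /complete_adj eq_sym. Qed.

Lemma complete_adj_irr : irreflexive complete_adj.
Proof. by move=> x; rewrite /complete_adj eqxx. Qed.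

Definition complete_graph : sgraph :=
  SGraph complete_adj_sym complete_adj_irr.

End Complete.

(* Main.v *)
Require Import Defs.
From mathcomp Require Import all_boot.
From mathcomp Require Import zify.

Set Implicit Arguments.
Unset Strict Implicit.
Unset Printing Implicit Defensive.

(** The incidences of K_n are its arcs: (v, {v, u}) is the arc from v to u.  A
conflict-free coloring gives different colors to distinct arcs sharing an end,
so the arcs of one color are vertex-disjoint and there are at most n./2 of
them.  The 2(n-1) arcs at one vertex need different colors; if n is odd,
n(n-1) arcs in classes of size at most (n-1)/2 need 2n colors.  Conversely, a
proper edge coloring of K_n, with each color split in two according to the
direction of the arc, is conflict-free: for n odd color the edge {x, y} by
x + y mod n; for n even do this modulo n - 1 on the first n - 1 vertices, where
the color 2x is missing at x and can be given to the edge from x to the last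
vertex. *)

(** The vertex [w] is the shared end. Values of [g] on the diagonal, where there is no arc, are
    unconstrained. *)
Definition arc_coloring n (T : Type) (g : 'I_n -> 'I_n -> T) :=
  forall w v u v' u', v != u -> v' != u' ->
  w \in [:: v; u] -> w \in [:: v'; u'] -> g v u = g v' u' -> v = v' /\ u = u'.

Section Incidences.
Variable n : nat.
Local Notation K := (complete_graph n).

Lemma incidence_arc (v u : 'I_n) :
  v != u -> @is_incidence K (v, [set v; u]).
Proof.
move=> nvu; rewrite /is_incidence /= set21 andbT inE.
apply/existsP; exists v; apply/existsP; exists u.
by rewrite /= /complete_adj nvu eqxx.
Qed.

(** The default of [odflt] is never reached, since an edge has an end other than [(val i).1]. *)
Definition incidence_end (i : incidence K) : 'I_n :=
  odflt (val i).1 [pick u in (val i).2 :\ (val i).1].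

Lemma incidence_endP (i : incidence K) :
  (val i).1 != incidence_end i /\ (val i).2 = [set (val i).1; incidence_end i].
Proof.
rewrite /incidence_end; case: i => -[v e] /= /andP[/=]; rewrite inE.
case/existsP=> x /existsP[y /andP[nxy /eqP->]] {e}; rewrite /= /complete_adj in nxy.
move=> /set2P[->|->]; case: pickP => [u|].
- by rewrite !inE => /andP[nu /orP[]/eqP uE]; move: nu; rewrite uE ?eqxx // eq_sym.
- by move=> /(_ y); rewrite !inE eqxx orbT andbT eq_sym nxy.
- rewrite !inE => /andP[nu /orP[]/eqP uE]; move: nu; rewrite uE ?eqxx // eq_sym.
  by split=> //; rewrite setUC.
- by move=> /(_ x); rewrite !inE eqxx nxy.
Qed.

Lemma colorable_of_arc_coloring (T : finType) (g : 'I_n -> 'I_n -> T) :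
  arc_coloring g -> conflict_free_colorable K #|T|.
Proof.
move=> g_arc; apply/existsP.
exists [ffun i => enum_rank (g (val i).1 (incidence_end i))].
apply/forallP=> i; apply/forallP=> j; apply/implyP=> /andP[nij /existsP[w]].
rewrite !inE => /andP[wi wj]; apply: contra nij.
rewrite !ffunE (inj_eq enum_rank_inj) => /eqP eq_g.
have [ni ei] := incidence_endP i; have [nj ej] := incidence_endP j.
move: wi wj; rewrite ei ej => wi wj.
have [||eq1 eq2] := g_arc w _ _ _ _ ni nj _ _ eq_g.
- by move: wi; rewrite !inE.
- by move: wj; rewrite !inE.
apply/eqP/val_inj; move: eq1 eq2 ei ej.
by case: (val i) (val j) => [a b] [c d] /= -> -> -> ->.
Qed.

Lemma arc_coloring_of_colorable k :
  2 <= n -> conflict_free_colorable K k ->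
  exists g : 'I_n -> 'I_n -> 'I_k, arc_coloring g.
Proof.
move=> hn /existsP[c /forallP cP].
have n01 : Ordinal (ltnW hn) != Ordinal hn by [].
(* A default for [insubd], taken only on the diagonal; [2 <= n] provides the edge for it. *)
pose i0 : incidence K := Sub (_, _) (incidence_arc n01).
exists (fun v u => c (insubd i0 (v, [set v; u]))).
move=> w v u v' u' nvu nvu' win win' /eqP.
set i := insubd i0 (v, _); set j := insubd i0 (v', _).
have iE : val i = (v, [set v; u]) by rewrite insubdK //; apply: incidence_arc.
have jE : val j = (v', [set v'; u']) by rewrite insubdK //; apply: incidence_arc.
have conf : conflict i j.
  apply/existsP; exists w; rewrite !inE iE jE /= !inE.
  by move: win win'; rewrite !inE => -> ->.
have [eq_ij _|nij] := eqVneq i j; last first.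
  by have /forallP/(_ j) := cP i; rewrite nij conf => /negPf->.
have [vE /setP/(_ u)] : (v, [set v; u]) = (v', [set v'; u']) by rewrite -iE -jE eq_ij.
by rewrite vE !inE eqxx orbT -vE [u == v]eq_sym (negPf nvu) => /esym/eqP.
Qed.

End Incidences.

Lemma arc_coloring_star n k (g : 'I_n.+1 -> 'I_n.+1 -> 'I_k) :
  arc_coloring g -> 2 * n <= k.
Proof.
move=> g_arc; pose w : 'I_n.+1 := ord0.
(* [lift w] runs over the vertices other than [w]; the boolean separates arcs leaving [w] from arcs
   entering it. *)
pose h (p : bool * 'I_n) := if p.1 then g w (lift w p.2) else g (lift w p.2) w.
suff /leq_card : injective h by rewrite card_prod card_bool !card_ord.
have nl i : w != lift w i := neq_lift w i.
have nr i : lift w i != w by rewrite eq_sym.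
have inl i : w \in [:: w; lift w i] by rewrite mem_head.
have inr i : w \in [:: lift w i; w] by rewrite !inE eqxx orbT.
move=> [[] i] [[] j]; rewrite /h /=.
- by case/(g_arc w _ _ _ _ (nl i) (nl j) (inl i) (inl j)) => _ /lift_inj->.
- by case/(g_arc w _ _ _ _ (nl i) (nr j) (inl i) (inr j)) => /eqP; rewrite (negPf (nl j)).
- by case/(g_arc w _ _ _ _ (nr i) (nl j) (inr i) (inl j)) => /eqP; rewrite (negPf (nr i)).
- by case/(g_arc w _ _ _ _ (nr i) (nr j) (inr i) (inr j)) => /lift_inj->.
Qed.

(** An arc is encoded by its tail [p.1] and an index [p.2] whose [lift] is the head, which excludes
    the diagonal. Arcs of one color are disjoint, so choosing the tail or the head of each is
    injective into the vertices. *)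
Lemma arc_coloring_class n (T : finType) (g : 'I_n.+1 -> 'I_n.+1 -> T) a :
  arc_coloring g ->
  2 * #|[set p : 'I_n.+1 * 'I_n | g p.1 (lift p.1 p.2) == a]| <= n.+1.
Proof.
move=> g_arc; set S := [set p | _].
pose h (q : bool * {p | p \in S}) : 'I_n.+1 :=
  let: (v, i) := val q.2 in if q.1 then v else lift v i.
suff /leq_card : injective h by rewrite card_prod card_bool card_ord card_sig.
case=> [b [[v i] vS]] [b' [[v' i'] vS']]; rewrite /h /= => eq_w.
have eq_g : g v (lift v i) = g v' (lift v' i').
  by move: vS vS'; rewrite !inE => /eqP-> /eqP->.
have [||eq_v] := g_arc (if b then v else lift v i) _ _ _ _
  (neq_lift v i) (neq_lift v' i') _ _ eq_g.
- by case: (b); rewrite !inE eqxx ?orbT.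
- by rewrite eq_w; case: (b'); rewrite !inE eqxx ?orbT.
move: vS' eq_w; rewrite -eq_v => vS' eq_w /lift_inj eq_i.
move: vS' eq_w; rewrite -eq_i => vS' eq_w.
congr (_, _); last exact: val_inj.
(* Different choices on the same arc would make its tail equal to its head. *)
move: eq_w; case: (b) (b') => [] [] // /eqP; last rewrite eq_sym.
  by rewrite (negPf (neq_lift _ _)).
by rewrite (negPf (neq_lift _ _)).
Qed.

Lemma arc_coloring_odd n k (g : 'I_n.+1 -> 'I_n.+1 -> 'I_k) :
  0 < n -> ~~ odd n -> arc_coloring g -> 2 * n.+1 <= k.
Proof.
move=> n_gt0 n_even g_arc.
have cardE : n.+1 * n = \sum_a #|[set p : 'I_n.+1 * 'I_n | g p.1 (lift p.1 p.2) == a]|.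
  transitivity #|{: 'I_n.+1 * 'I_n}|; first by rewrite card_prod !card_ord.
  rewrite -[LHS]sum1_card.
  rewrite (partition_big (fun p : 'I_n.+1 * 'I_n => g p.1 (lift p.1 p.2)) predT) //=.
  by apply: eq_bigr => a _; rewrite -sum1_card; apply: eq_bigl => p; rewrite inE.
rewrite -(leq_pmul2r n_gt0) -mulnA cardE big_distrr /=.
rewrite -[k in k * n]card_ord -sum_nat_const; apply: leq_sum => a _.
(* As [n.+1] is odd, the bound [n.+1] on twice the class size improves to [n]. *)
have := arc_coloring_class a g_arc; set s := #|_|; lia.
Qed.

(** A shared end and equal values of [f] force the same edge; the bit [v < u] then separates its two
    directions. *)
Lemma arc_coloring_of_edge_coloring n (T : eqType) (f : 'I_n -> 'I_n -> T) :
  (forall x y, f x y = f y x) ->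
  (forall x y z, x != y -> x != z -> f x y = f x z -> y = z) ->
  arc_coloring (fun v u => (f v u, v < u)).
Proof.
move=> f_sym f_inj w v u v' u' nvu nvu' win win' [eq_f].
have nuv : u != v by rewrite eq_sym.
have nuv' : u' != v' by rewrite eq_sym.
move: win win'; rewrite !inE => /orP[]/eqP wE /orP[]/eqP wE'.
- by move: nvu eq_f; rewrite -wE -wE' in nvu' * => nvu /f_inj->.
- move: eq_f; rewrite [f v' u']f_sym -wE -wE' in nvu nuv' * => /f_inj-> //.
  by move: nuv'; case: ltngtP => // /val_inj->; rewrite eqxx.
- move: eq_f; rewrite [f v u]f_sym -wE -wE' in nuv nvu' * => /f_inj-> //.
  by move: nvu'; case: ltngtP => // /val_inj->; rewrite eqxx.
- by move: eq_f; rewrite [f v u]f_sym [f v' u']f_sym -wE -wE' in nuv nuv' * => /f_inj->.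
Qed.

Lemma colorable_of_edge_coloring n k (f : nat -> nat -> nat) :
  (forall x y, f x y = f y x) ->
  (forall x y z, x < n -> y < n -> z < n -> x != y -> x != z ->
     f x y = f x z %[mod k.+1] -> y = z) ->
  conflict_free_colorable (complete_graph n) (2 * k.+1).
Proof.
move=> f_sym f_inj.
have -> : 2 * k.+1 = #|{: 'I_k.+1 * bool}|.
  by rewrite card_prod card_ord card_bool mulnC.
pose f' (x y : 'I_n) : 'I_k.+1 := Ordinal (ltn_pmod (f x y) (ltn0Sn k)).
apply: (@colorable_of_arc_coloring _ _ (fun v u => (f' v u, v < u))).
apply: arc_coloring_of_edge_coloring => [x y|x y z nxy nxz /(congr1 val) /= eq_f].
  by apply: val_inj; rewrite /= f_sym.
exact: val_inj (f_inj x y z (ltn_ord x) (ltn_ord y) (ltn_ord z) nxy nxz eq_f).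
Qed.

Lemma modn_inj_small m x y : x < m -> y < m -> x = y %[mod m] -> x = y.
Proof. by move=> xm ym; rewrite !modn_small. Qed.

(** An odd [m] dividing [2 * (x - y)] divides [x - y], which is below [m] and hence zero. *)
Lemma addnn_modn_inj m x y :
  odd m -> x < m -> y < m -> x + x = y + y %[mod m] -> x = y.
Proof.
move=> m_odd; wlog leyx : x y / y <= x => [wlog_xy xm ym eq_m|xm ym /eqP].
  by case/orP: (leq_total y x) => le; [|apply/esym]; apply: wlog_xy.
rewrite !addnn eqn_mod_dvd ?leq_double // -doubleB -mul2n Gauss_dvdr ?coprimen2 //.
case: (posnP (x - y)) => [|lt0 /(dvdn_leq lt0)]; lia.
Qed.

Lemma colorable_odd n : conflict_free_colorable (complete_graph n.+1) (2 * n.+1).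
Proof.
apply: (@colorable_of_edge_coloring _ _ addn) => [|x y z _ yn zn _ _ /eqP].
  exact: addnC.
by rewrite eqn_modDl => /eqP; apply: modn_inj_small.
Qed.

Lemma colorable_even n :
  odd n -> conflict_free_colorable (complete_graph n.+1) (2 * n).
Proof.
case: n => // m m_odd; set n := m.+1 in m_odd *.
pose f x y := if x == n then y + y else if y == n then x + x else x + y.
apply: (@colorable_of_edge_coloring _ _ f) => [x y|x y z xn yn zn nxy nxz].
  rewrite /f; have [->|_] := eqVneq x n; have [yn|_] := eqVneq y n => //.
    by rewrite yn.
  exact: addnC.
rewrite /f -/n; case: (eqVneq x n) => [xE|nx].
  (* At the last vertex [n] the colors are [y + y] and [z + z], and doubling is injective modulo the
     odd [n]. *)
  by apply: addnn_modn_inj; lia.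
case: (eqVneq y n) (eqVneq z n) => [->|ny] [->|nz] // /eqP;
  rewrite eqn_modDl => /eqP eq_m.
(* If exactly one of [y] and [z] is [n], cancelling [x] makes the other one equal to [x], which is
   excluded. *)
- by have := @modn_inj_small n x z; lia.
- by have := @modn_inj_small n y x; lia.
- by apply: (@modn_inj_small n) => //; lia.
Qed.

Theorem theorem2p8 (n : nat) (hn : 2 <= n) :
  (~~ odd n -> cf_incidence_chromatic_number (complete_graph n) = 2 * n - 2) /\
  (odd n -> cf_incidence_chromatic_number (complete_graph n) = 2 * n).
Proof.
rewrite /cf_incidence_chromatic_number; case: ex_minnP => k k_col k_min.
have [g g_arc] := arc_coloring_of_colorable hn k_col.
(* From here there are [n.+1] vertices, so the parity of [n] is opposite to that of the number of
   vertices. *)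
case: n hn k_col k_min g g_arc => // n hn k_col k_min g g_arc.
split=> /= n_par; apply/eqP; rewrite eqn_leq.
- rewrite mulnS addKn (arc_coloring_star g_arc) andbT.
  by apply/k_min/colorable_even; rewrite -[odd n]negbK.
- by rewrite (arc_coloring_odd hn n_par g_arc) andbT; apply/k_min/colorable_odd.
Qed.
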